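(* Let $T$ be an $r$-interval exchange transformation of $[0,1)$ with $\omega(T)=\omega_0$. Then $C_\psi(T)\le\tau(T)\le(r-1)\,\omega_0$. In particular, if $\omega(T)=0$ then $\tau(T)=C_\psi(T)=0$.
   Context: An $r$-interval exchange transformation is given by a permutation $\pi$ of $\{1,\dots,r\}$ and lengths $\ell_i>0$ with $\sum\ell_i=1$: with $s_0=0$, $s_k=\sum_{i\le k}\ell_i$, $I_k=[s_{k-1},s_k)$, $T(x)=x-\sum_{i<k}\ell_i+\sum_{\pi(i')<\pi(k)}\ell_{i'}$ for $x\in I_k$. Let $\oplus,\ominus$ be addition/subtraction mod $1$. $\Delta(T)=\{T(x)\ominus x\}$, $\Delta'(T)=\{u\ominus v:u,v\in\Delta(T)\}$, $\Delta'_n(T)=\bigcup_{k=1}^n\Delta'(T^k)$, $\tau(T)=\limsup_n\frac{\log\operatorname{card}\Delta'_n(T)}{\log n}$. For $n\in\mathbb N$, $D_n(T)=\sup_{x\in[0,1),\,0<a<b<1}\big|\frac1n\sum_{k=0}^{n-1}\theta_{a,b}(T^kx)-(b-a)\big|$, where $\theta_{a,b}$ is the indicator of $(a,b)$, and $\omega(T)=\limsup_{n\to\infty}\frac{\log(nD_n(T))}{\log n}$. With $\lambda$ Lebesgue measure and $\|t\|$ the distance from $t$ to the nearest integer, $C_\psi(T)=\sup\big(\{0\}\cup\{\alpha>0:\liminf_n n^\alpha\|T^nx-T^ny\|=0\text{ for }\lambda\times\lambda\text{-a.e. }(x,y)\}\big)$. *)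

(* Defs.v *)
From HB Require Import structures.
From mathcomp Require Import all_boot all_order all_algebra all_fingroup.
From mathcomp Require Import finmap all_classical all_reals all_analysis.
Set Implicit Arguments. Unset Strict Implicit. Unset Printing Implicit Defensive.
Import Order.TTheory GRing.Theory Num.Theory.
Import numFieldNormedType.Exports.
Local Open Scope classical_set_scope.
Local Open Scope ring_scope.

Section IET.
Variable R : realType.

Definition frac (t : R) : R := t - (Num.floor t)%:~R.
Definition oplus1 (u v : R) : R := frac (u + v).
Definition ominus1 (u v : R) : R := frac (u - v).
Definition distZ (t : R) : R := Num.min (frac t) (1 - frac t).

(** Interval exchange transformation with r intervals, permutation pi
   (indices 1..r rendered as 'I_r = {0..r-1}) and lengths l.
   s_(k-1) = \sum_(i < k) l i is the left endpoint of I_k, s_k its right one. *)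
Definition left_pt (r : nat) (l : 'I_r -> R) (k : 'I_r) : R :=
  \sum_(i < r | (i < k)%N) l i.
Definition right_pt (r : nat) (l : 'I_r -> R) (k : 'I_r) : R :=
  \sum_(i < r | (i <= k)%N) l i.
Definition shift (r : nat) (pi : 'S_r) (l : 'I_r -> R) (k : 'I_r) : R :=
  - left_pt l k + \sum_(i < r | (pi i < pi k)%N) l i.

(** T(x) = x + shift on I_k for x in I_k; (T is the identity outside [0,1),
    which is irrelevant since [0,1) is T-invariant). *)
Definition iet (r : nat) (pi : 'S_r) (l : 'I_r -> R) (x : R) : R :=
  x + \sum_(k < r) (if (left_pt l k <= x) && (x < right_pt l k)
                     then shift pi l k else 0).

Definition unit_itv : set R := `[0, 1[%classic.

Definition Delta (f : R -> R) : set R := [set ominus1 (f x) x | x in unit_itv].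
Definition Delta' (f : R -> R) : set R :=
  [set ominus1 uv.1 uv.2 | uv in Delta f `*` Delta f].
Definition Delta'n (f : R -> R) (n : nat) : set R :=
  \bigcup_(k in [set k : nat | (1 <= k <= n)%N]) Delta' (iter k f).

Definition tau_term (f : R -> R) (n : nat) : \bar R :=
  if pselect (finite_set (Delta'n f n))
  then (ln (#|` fset_set (Delta'n f n)|%:R) / ln n%:R)%:E
  else +oo%E.

Definition tau (f : R -> R) : \bar R := limn_esup (tau_term f).

Definition theta (a b : R) (y : R) : R := if (a < y) && (y < b) then 1 else 0.

Definition discrepancy (f : R -> R) (n : nat) : R :=
  sup [set y : R | exists x a b, [/\ unit_itv x, 0 < a, a < b, b < 1 &
       y = `| n%:R^-1 * (\sum_(k < n) theta a b (iter k f x)) - (b - a) |]].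

Definition omega (f : R -> R) : \bar R :=
  limn_esup (fun n : nat => (ln (n%:R * discrepancy f n) / ln n%:R)%:E).

Definition Cpsi (f : R -> R) : \bar R :=
  ereal_sup ([set 0%E] `|`
    [set (alpha%:E)%E | alpha in [set alpha : R | 0 < alpha /\
      {ae (lebesgue_measure \x lebesgue_measure)%E,
         forall z : R * R, unit_itv z.1 -> unit_itv z.2 ->
           limn_einf (fun n : nat =>
             ((n%:R `^ alpha) * distZ (iter n f z.1 - iter n f z.2))%:E)
           = 0%E}]]).

End IET.

(* Main.v *)
(* For the first inequality, T^n x - T^n y differs from x - y by an element of
   Delta'_n. If tau < beta < alpha then, on a dyadic block of times n ~ 2^k, the
   event n^alpha ||T^n x - T^n y|| < 1 is contained in about 2^(k beta) strips around
   lines x - y = c, each of measure about 2^(-k alpha). These measures are summable, so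
   by Borel-Cantelli the event occurs finitely often for almost every (x, y).

   For the second inequality, T^n x - x is the sum of the translation lengths of the r
   pieces weighted by the numbers of visits to them. Two orbits of length n visit
   a given piece equally often up to 2 n D_n, and their total numbers of visits agree,
   so an element of Delta'(T^n) is determined by r - 1 integers of size at most 2 n D_n. *)

Require Import Defs.
From HB Require Import structures.
From mathcomp Require Import all_boot all_order all_algebra all_fingroup.
From mathcomp Require Import finmap all_classical all_reals all_analysis.
From mathcomp Require Import ring lra zify.
Import Order.TTheory GRing.Theory Num.Theory.
Set Implicit Arguments. Unset Strict Implicit. Unset Printing Implicit Defensive.
Local Open Scope ring_scope.

Local Notation frac := Defs.frac.
Local Notation shift := Defs.shift.

(** * Arithmetic modulo 1 *)

Lemma frac_itv (R : realType) (t : R) : 0 <= frac t < 1.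
Proof.
by have := floor_itv t; rewrite intrD1 /Defs.frac => /andP[h1 h2]; apply/andP; split; lra.
Qed.

Lemma fracDz (R : realType) (t : R) (m : int) : frac (t + m%:~R) = frac t.
Proof. by rewrite /Defs.frac floorDrz ?intr_int// intrKfloor intrD; ring. Qed.

Lemma ominus1_ominus1 (R : realType) (a b c d : R) :
  ominus1 (ominus1 a b) (ominus1 c d) = frac ((a - b) - (c - d)).
Proof.
rewrite /ominus1 -(fracDz _ (Num.floor (a - b) - Num.floor (c - d))).
by congr frac; rewrite /Defs.frac intrB; ring.
Qed.

(** * Upper limits along a filter, and cardinality of finite images *)

Section limf_esup.
Context (T : choiceType) (X : filteredType T) (R : realType).
Context (F : set_system X) (FF : ProperFilter F).
Implicit Type u : X -> \bar R.

Lemma limf_esup_lt u b : (limf_esup u F < b)%E -> \forall n \near F, (u n < b)%E.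
Proof.
rewrite limf_esupE => /ereal_inf_lt[_ [V FV <-]] Vb.
by apply: filterS FV => n Vn; apply: le_lt_trans Vb; apply: ereal_sup_ubound; exists n.
Qed.

Lemma limf_esup_le u b : (\forall n \near F, (u n <= b)%E) -> (limf_esup u F <= b)%E.
Proof.
move=> ub; rewrite limf_esupE; apply: ge_ereal_inf; eexists; first by eexists; first exact: ub.
by apply: ge_ereal_sup => _ [n /= un <-].
Qed.

Lemma limf_esup_ge u b : (\forall n \near F, (b <= u n)%E) -> (b <= limf_esup u F)%E.
Proof.
move=> ub; rewrite limf_esupE; apply: le_ereal_inf_tmp => _ [V FV <-].
have [n [/= bn Vn]] := filter_ex (filterI ub FV).
by apply: le_ereal_sup_tmp; exists (u n) => //; exists n.
Qed.

End limf_esup.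

Lemma finite_subset_range (I : finType) (T : choiceType) (g : I -> T) (A : set T) :
  (A `<=` range g)%classic -> finite_set A /\ (#|` fset_set A| <= #|I|)%N.
Proof.
move=> Ag; have fA : finite_set A by apply: sub_finite_set Ag _; exact: finite_image.
split=> //; rewrite cardE -(size_map g).
apply: leq_trans (size_undup _); rewrite -(size_seq_fset tt).
apply/fsubset_leq_card/fsubsetP => x; rewrite in_fset_set// inE => /Ag[i _ <-].
by rewrite seq_fsetE map_f// mem_enum.
Qed.

(** * Discrepancy and visit counts *)

Section discrepancy.
Context (R : realType) (f : R -> R).

Lemma theta_avg_itv (n : nat) (x a b : R) :
  0 <= n%:R^-1 * (\sum_(k < n) theta a b (iter k f x)) <= 1.
Proof.
have -> : \sum_(k < n) theta a b (iter k f x) =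
    (\sum_(k < n) ((a < iter k f x) && (iter k f x < b))%R)%:R.
  by rewrite natr_sum; apply: eq_bigr => k _; rewrite /theta; case: ifP.
rewrite mulr_ge0 ?invr_ge0//=; case: n => [|n]; first by rewrite invr0 mul0r.
rewrite mulrC ler_pdivrMr// mul1r ler_nat -[leqRHS]card_ord -sum1_card.
by apply: leq_sum => i _; case: (_ && _).
Qed.

Lemma discrepancy_term_le1 (n : nat) (x a b : R) : 0 < a -> a < b -> b < 1 ->
  `| n%:R^-1 * (\sum_(k < n) theta a b (iter k f x)) - (b - a) | <= 1.
Proof. by move=> *; have /andP[? ?] := theta_avg_itv n x a b; rewrite ler_norml; lra. Qed.

Lemma discrepancy_le1 (n : nat) : discrepancy f n <= 1.
Proof.
apply: ge_sup => [|_ [x [a [b [_ a0 ab b1 ->]]]]]; last exact: discrepancy_term_le1.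
(* Any admissible triple will do here: bounding a [sup] from above requires a nonempty set. *)
by eexists; exists 0, (3^-1), (2^-1); split; last reflexivity;
   rewrite ?/unit_itv /= ?in_itv/=; lra.
Qed.

Lemma discrepancy_ge (n : nat) (x a b : R) : 0 <= x < 1 -> 0 < a -> a < b -> b < 1 ->
  `| n%:R^-1 * (\sum_(k < n) theta a b (iter k f x)) - (b - a) | <= discrepancy f n.
Proof.
move=> x01 a0 ab b1; apply: ub_le_sup; last first.
  by exists x, a, b; split; rewrite /unit_itv/= ?in_itv.
by exists 1 => _ [x' [a' [b' [_ a'0 a'b' b'1 ->]]]]; exact: discrepancy_term_le1.
Qed.

Lemma mul_discrepancy_ge (n : nat) (x a b : R) : 0 <= x < 1 -> 0 < a -> a < b -> b < 1 ->
  `| \sum_(k < n) theta a b (iter k f x) - n%:R * (b - a) | <= n%:R * discrepancy f n.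
Proof.
move=> x01 a0 ab b1; case: n => [|n]; first by rewrite big_ord0 !mul0r subrr normr0.
have n0 : 0 < n.+1%:R :> R by rewrite ltr0n.
set S := \sum_(k < n.+1) _.
have -> : S - n.+1%:R * (b - a) = n.+1%:R * (n.+1%:R^-1 * S - (b - a)).
  by rewrite [RHS]mulrBr mulrA mulfV ?mul1r// gt_eqF.
by rewrite normrM gtr0_norm// ler_pM2l//; exact: discrepancy_ge.
Qed.

(* A short interval around an orbit point has mass at least [1/n] and length almost [0]. *)
Lemma mul_discrepancy_ge1 (n : nat) : (0 < n)%N -> 1 <= n%:R * discrepancy f n.
Proof.
move=> n0; apply/ler_addgt0Pr => e e0.
(* The bound [1/4] keeps the interval around [1/2] inside [(0, 1)]; the other bound makes [n] times
   its length at most [e]. *)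
pose d := Num.min (4^-1) (e / (4 * n%:R)).
have n0R : 0 < n%:R :> R by rewrite ltr0n.
have d0 : 0 < d by rewrite lt_min divr_gt0 ?mulr_gt0//; lra.
have dn : n%:R * (2 * d) <= e.
  have : d <= e / (4 * n%:R) by rewrite ge_min lexx orbT.
  by rewrite ler_pdivlMr ?mulr_gt0//; nra.
have d4 : d <= 4^-1 by rewrite ge_min lexx.
have x01 : 0 <= (2^-1 : R) < 1 by apply/andP; lra.
have /(_ _ _ _)/(le_trans (ler_norm _)) := @mul_discrepancy_ge n _ (2^-1 - d) (2^-1 + d) x01.
have -> : 2^-1 + d - (2^-1 - d) = 2 * d by ring.
suff : 1 <= \sum_(k < n) theta (2^-1 - d) (2^-1 + d) (iter k f 2^-1).
  by move=> s1 h; have := h ltac:(lra) ltac:(lra) ltac:(lra); lra.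
case: n n0 {n0R dn} @d d0 d4 => // n _ d d0 d4; rewrite big_ord_recl /= {1}/theta.
rewrite ifT ?lerDl; last by apply/andP; lra.
by apply: sumr_ge0 => i _; rewrite /theta; case: ifP.
Qed.

End discrepancy.

(** Provides the room to move an endpoint [c] to the left without crossing a point of a finite
    orbit. *)
Lemma finite_gap (R : realType) (s : seq R) (c : R) :
  exists2 e, 0 < e & forall y, y \in s -> y < c -> y <= c - e.
Proof.
elim: s => [|z s [e e0 es]]; first by exists 1.
have [zc|cz] := ltP z c; last first.
  by exists e => // y; rewrite inE => /predU1P[->|/es//]; lra.
exists (Num.min e (c - z)); first by rewrite lt_min e0; lra.
have m1 : Num.min e (c - z) <= e by rewrite ge_min lexx.
have m2 : Num.min e (c - z) <= c - z by rewrite ge_min lexx orbT.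
move=> y; rewrite inE => /predU1P[->|/es h /h]; lra.
Qed.

(** Half-open, like the pieces of an interval exchange, whereas [theta] tests open intervals. *)
Definition visits (R : realType) (f : R -> R) (n : nat) (x a b : R) : nat :=
  (\sum_(k < n) ((a <= iter k f x) && (iter k f x < b))%R)%N.

(* Shifting both endpoints slightly to the left turns the half-open interval into
   an open one containing the same orbit points, with the same length. *)
Lemma visits_discrepancy (R : realType) (f : R -> R) (n : nat) (x a b : R) :
  0 <= x < 1 -> 0 < a -> a < b -> b <= 1 ->
  `| (visits f n x a b)%:R - n%:R * (b - a) |
    <= n%:R * discrepancy f n.
Proof.
move=> x01 a0 ab b1; pose s := [seq iter k f x | k <- iota 0 n].
have [e1 e10 h1] := finite_gap s a; have [e2 e20 h2] := finite_gap s b.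
pose e := Num.min (a / 2) (Num.min e1 e2).
have e0 : 0 < e by rewrite !lt_min e10 e20; lra.
have ea : e <= a / 2 by rewrite ge_min lexx.
have ee1 : e <= e1 by rewrite !ge_min lexx orbT.
have ee2 : e <= e2 by rewrite !ge_min lexx !orbT.
(* Halving makes the weak bounds of [finite_gap] strict. The shift also gives [b - e' < 1] when
   [b = 1], as happens for the last piece. *)
pose e' := e / 2.
have -> : (visits f n x a b)%:R =
   \sum_(k < n) theta (a - e') (b - e') (iter k f x).
  rewrite /visits natr_sum; apply: eq_bigr => k _; rewrite /theta.
  have ys : iter k f x \in s.
    by apply/mapP; exists (k : nat) => //; rewrite mem_iota add0n ltn_ord.
  move: (iter k f x) ys => y ys.
  have -> : (a <= y) = (a - e' < y).
    apply/idP/idP => [|h]; first by rewrite /e'; lra.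
    by rewrite leNgt; apply/negP => /(h1 _ ys); rewrite /e' in h; lra.
  have -> : (y < b) = (y < b - e').
    by apply/idP/idP => [/(h2 _ ys)|]; rewrite /e'; lra.
  by case: ifP.
have -> : b - a = (b - e') - (a - e') by ring.
apply: mul_discrepancy_ge => //; rewrite /e'; lra.
Qed.

(** * Pieces, orbits and visit counts of an interval exchange *)

Section iet.
Context (R : realType) (r : nat) (pi : 'S_r) (l : 'I_r -> R).
Hypotheses (l_pos : forall i, 0 < l i) (l_sum : \sum_(i < r) l i = 1).
Local Notation T := (iet pi l).

Lemma sum_lengths_ge0 (P : pred 'I_r) : 0 <= \sum_(i < r | P i) l i.
Proof. by apply: sumr_ge0 => i _; exact: ltW. Qed.

(** Serves both orderings of the pieces: it gives [right_pt l k <= 1] in the domain and [T x < 1] in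
    the image. *)
Lemma sum_lengths_notin (P : pred 'I_r) (k : 'I_r) :
  ~~ P k -> \sum_(i < r | P i) l i + l k <= 1.
Proof.
move=> Pk; rewrite -l_sum [leRHS](bigID P)/= lerD2l (bigD1 k)//= lerDl.
exact: sum_lengths_ge0.
Qed.

Lemma right_ptE (k : 'I_r) : right_pt l k = left_pt l k + l k.
Proof.
rewrite /right_pt /left_pt (bigD1 k)//= addrC; congr (_ + _); apply: eq_bigl => i.
by rewrite [RHS]ltn_neqAle andbC.
Qed.

Lemma right_pt_le_left_pt (j k : 'I_r) : (j < k)%N -> right_pt l j <= left_pt l k.
Proof.
move=> jk; rewrite /left_pt [leRHS](bigID (fun i : 'I_r => (i <= j)%N))/=.
rewrite (eq_bigl (fun i : 'I_r => (i <= j)%N)) ?lerDl ?sum_lengths_ge0// => i.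
by apply/idP/idP => [/andP[]|ij] //; rewrite ij andbT (leq_ltn_trans ij).
Qed.

Lemma left_pt_gt0 (k : 'I_r) : (0 < k)%N -> 0 < left_pt l k.
Proof.
move=> k0; have r0 : (0 < r)%N by exact: leq_ltn_trans (ltn_ord k).
apply: (lt_le_trans (l_pos (Ordinal r0))); rewrite /left_pt (bigD1 (Ordinal r0))//= lerDl.
exact: sum_lengths_ge0.
Qed.

Lemma right_pt_le1 (k : 'I_r) : right_pt l k <= 1.
Proof. by rewrite right_ptE sum_lengths_notin// ltnn. Qed.

Lemma pieceP (x : R) : 0 <= x < 1 ->
  exists k : 'I_r, forall j, (left_pt l j <= x) && (x < right_pt l j) = (j == k).
Proof.
move=> /andP[x0 x1]; pose S m := \sum_(i < r | (i < m)%N) l i.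
have Sr : S r = 1 by rewrite -l_sum; apply: eq_bigl => i; rewrite ltn_ord.
have exS : exists m, x < S m by exists r; rewrite Sr.
(* The least [m] with [x < S m] is positive because [S 0 = 0 <= x]; the piece containing [x] is its
   predecessor [k]. *)
case: (ex_minnP exS) => -[|k] Sk kmin.
  by move: Sk; rewrite /S big_pred0// ltNge x0.
have kr : (k < r)%N by apply: kmin; rewrite Sr.
have xk : left_pt l (Ordinal kr) <= x by rewrite leNgt; apply/negP => /kmin; rewrite ltnn.
exists (Ordinal kr) => j; apply/idP/eqP => [/andP[lj rj]|->]; last by rewrite xk.
apply/val_inj => /=; case: (ltngtP j k) => // jk.
  have rj' := right_pt_le_left_pt (k := Ordinal kr) jk.
  by have := le_lt_trans xk (lt_le_trans rj rj'); rewrite ltxx.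
have lj' := right_pt_le_left_pt (j := Ordinal kr) jk.
by have := lt_le_trans (Sk : x < right_pt l (Ordinal kr)) (le_trans lj' lj); rewrite ltxx.
Qed.

(** If [s] is the total length of the pieces placed before piece [k] by [pi], then [T] carries that
    piece onto [[s, s + l k)], which lies in [[0, 1)]. *)
Lemma iet_itv (x : R) : 0 <= x < 1 -> 0 <= T x < 1.
Proof.
move=> x01; have [k kP] := pieceP x01; have := kP k; rewrite eqxx => /andP[lk rk].
rewrite /iet (bigD1 k)//= kP eqxx big1 => [|j /negPf jk]; last by rewrite kP jk.
have := @sum_lengths_notin (fun i => (pi i < pi k)%N) k; rewrite ltnn => /(_ isT).
have := sum_lengths_ge0 (fun i => (pi i < pi k)%N).
move: rk; rewrite /Defs.shift /= right_ptE; set s := \sum_(_ | _) _ => rk s0 s1.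
by apply/andP; split; lra.
Qed.

Lemma iter_iet_itv (n : nat) (x : R) : 0 <= x < 1 -> 0 <= iter n T x < 1.
Proof. by move=> x01; elim: n => //= n; exact: iet_itv. Qed.

Lemma iter_ietE (n : nat) (x : R) : iter n T x =
  x + \sum_(i < r) (visits T n x (left_pt l i) (right_pt l i))%:R * shift pi l i.
Proof.
elim: n => [|n IH]; first by rewrite big1 ?addr0// => i _; rewrite /visits big_ord0 mul0r.
rewrite iterS /iet -/T {1}IH -addrA -big_split/=; congr (_ + _); apply: eq_bigr => i _.
by rewrite /visits big_ord_recr/= natrD mulrDl; case: ifP; rewrite ?mul1r ?mul0r.
Qed.

Lemma sum_visits (n : nat) (x : R) : 0 <= x < 1 ->
  (\sum_(i < r) visits T n x (left_pt l i) (right_pt l i) = n)%N.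
Proof.
move=> x01; rewrite /visits exchange_big/= -[RHS]card_ord -sum1_card.
apply: eq_bigr => j _; have [k kP] := pieceP (iter_iet_itv j x01).
by rewrite (bigD1 k)//= kP eqxx big1// => i /negPf ik; rewrite kP ik.
Qed.

(** The discrepancy only tests intervals with [0 < a], which excludes the first piece since it
    starts at [0]. The count of that piece is controlled through [sum_visits] instead. *)
Lemma visits_left_pt (n : nat) (x : R) (i : 'I_r) : 0 <= x < 1 -> (0 < i)%N ->
  `|(visits T n x (left_pt l i) (right_pt l i))%:R - n%:R * l i| <= n%:R * discrepancy T n.
Proof.
move=> x01 i0; have := right_ptE i => e; have -> : l i = right_pt l i - left_pt l i by lra.
by apply: visits_discrepancy; rewrite ?left_pt_gt0 ?right_pt_le1// e ltrDl.
Qed.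

End iet.

(** * Counting the elements of [Delta'n] for an interval exchange *)

Section Delta'_iet.
Context (R : realType) (r : nat) (pi : 'S_r.+1) (l : 'I_r.+1 -> R).
Hypotheses (l_pos : forall i, 0 < l i) (l_sum : \sum_(i < r.+1) l i = 1).
Local Notation T := (iet pi l).
Local Notation N n x i := (visits T n x (left_pt l i) (right_pt l i)).

(* The visit counts of two orbits have the same sum, so the first one is redundant. *)
Lemma iter_iet_sub (n : nat) (x y : R) : 0 <= x < 1 -> 0 <= y < 1 ->
  (iter n T x - x) - (iter n T y - y) =
  \sum_(i < r) ((N n x (lift ord0 i))%:R - (N n y (lift ord0 i))%:R) *
    (shift pi l (lift ord0 i) - shift pi l ord0).
Proof.
move=> x01 y01; rewrite !(iter_ietE _ _ n).
have := f_equal (fun m : nat => m%:R : R) (sum_visits pi l_pos l_sum n x01).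
have := f_equal (fun m : nat => m%:R : R) (sum_visits pi l_pos l_sum n y01).
rewrite !natr_sum !big_ord_recl/= => ey ex.
transitivity (((N n x ord0)%:R - (N n y ord0)%:R) * shift pi l ord0 +
  \sum_(i < r) ((N n x (lift ord0 i))%:R - (N n y (lift ord0 i))%:R) * shift pi l (lift ord0 i)).
  under [in RHS]eq_bigr do rewrite mulrBl.
  by rewrite sumrB; ring.
under [in RHS]eq_bigr do rewrite mulrBr.
rewrite sumrB -mulr_suml sumrB addrC -mulNr; congr (_ + _ * _).
by lra.
Qed.

(** The real coefficients in [iter_iet_sub] do not depend on the time, so a single box of integer
    vectors covers the whole union over [k <= n], without an extra factor [n]. *)
Lemma card_Delta'n_iet (n : nat) (B : R) : 0 <= B ->
  (forall k, (1 <= k <= n)%N -> k%:R * discrepancy T k <= B) ->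
  finite_set (Delta'n T n) /\
  (#|` fset_set (Delta'n T n)| <= (2 * Num.truncn (2 * B)).+1 ^ r)%N.
Proof.
move=> B0 DB; set M := Num.truncn _.
(* The entry [v i] encodes the integer [v i - M], which ranges from [- M] to [M]. *)
pose g (v : {ffun 'I_r -> 'I_(2 * M).+1}) : R :=
  frac (\sum_(i < r) ((v i)%:R - M%:R) * (shift pi l (lift ord0 i) - shift pi l ord0)).
suff /finite_subset_range : (Delta'n T n `<=` range g)%classic.
  by rewrite card_ffun !card_ord.
move=> _ [k /= kn [[_ _] [/= [x x01 <-] [y y01 <-]] <-]].
rewrite /unit_itv/= in_itv/= in x01 y01; rewrite /= in_itv/= in y01.
rewrite /= ominus1_ominus1 iter_iet_sub//.
have NM (i : 'I_r) : (N k x (lift ord0 i) <= N k y (lift ord0 i) + M)%N /\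
                     (N k y (lift ord0 i) <= N k x (lift ord0 i) + M)%N.
  have := @visits_left_pt _ _ pi l l_pos l_sum k x (lift ord0 i) x01 isT.
  have := @visits_left_pt _ _ pi l l_pos l_sum k y (lift ord0 i) y01 isT.
  have /andP[_ M2] : M%:R <= 2 * B < M.+1%:R by apply: truncn_itv; rewrite mulr_ge0.
  have := DB _ kn; move: M2.
  move: (N k x _) (N k y _) => p q; rewrite !ler_norml -!natr1 => M2 DB' /andP[h1 h2] /andP[h3 h4].
  (* Both counts are within [B] of the same number, so they differ by at most [2 * B < M + 1]; being
     integers, they differ by at most [M]. *)
  have pq : p%:R < (q + M).+1%:R :> R by rewrite -natr1 natrD; lra.
  have qp : q%:R < (p + M).+1%:R :> R by rewrite -natr1 natrD; lra.
  by move: pq qp; rewrite !ltr_nat !ltnS.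
exists [ffun i => inord (N k x (lift ord0 i) + M - N k y (lift ord0 i))] => //.
rewrite /g; congr frac; apply: eq_bigr => i _; congr (_ * _); rewrite ffunE.
have [h1 h2] := NM i; rewrite inordK; last by lia.
by rewrite natrB// natrD; ring.
Qed.

End Delta'_iet.

(** * Bounds on the exponents, and the second inequality *)

Lemma ln_natr_gt0 (R : realType) (n : nat) : (1 < n)%N -> 0 < ln n%:R :> R.
Proof. by move=> n1; rewrite ln_gt0// ltr1n. Qed.

Lemma omega_ge0 (R : realType) (f : R -> R) : (0 <= omega f)%E.
Proof.
apply: limf_esup_ge; near=> n; have n1 : (1 < n)%N by near: n; exact: nbhs_infty_gt.
rewrite lee_fin divr_ge0 ?(ltW (ln_natr_gt0 _ n1))// ln_ge0//.
by apply: mul_discrepancy_ge1; exact: ltnW.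
Unshelve. all: by end_near. Qed.

(** Together with [omega_ge0] this makes [omega f] finite, so that it can be handled as a real
    exponent. *)
Lemma omega_le1 (R : realType) (f : R -> R) : (omega f <= 1)%E.
Proof.
apply: limf_esup_le; near=> n; have n1 : (1 < n)%N by near: n; exact: nbhs_infty_gt.
have n0 : 0 < n%:R :> R by rewrite ltr0n ltnW.
rewrite lee_fin ler_pdivrMr ?ln_natr_gt0// mul1r ler_ln ?posrE//.
  by rewrite ler_piMr ?discrepancy_le1// ltW.
by apply: lt_le_trans (mul_discrepancy_ge1 f (ltnW n1)).
Unshelve. all: by end_near. Qed.

(** The set contains [d] minus itself for any displacement [d] of [f]. Positivity is required when
    logarithms of cardinalities are compared. *)
Lemma card_Delta'n_gt0 (R : realType) (f : R -> R) (n : nat) : (0 < n)%N ->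
  finite_set (Delta'n f n) -> (0 < #|` fset_set (Delta'n f n)|)%N.
Proof.
move=> n0 fD; rewrite cardfs_gt0; apply/fset0Pn; pose d := ominus1 (f 0) 0.
exists (ominus1 d d); rewrite in_fset_set// inE; exists 1%N => //=.
have Dd : Delta f d by exists 0 => //; rewrite /unit_itv/= in_itv/= lexx ltr01.
by exists (d, d).
Qed.

Lemma tau_ge0 (R : realType) (f : R -> R) : (0 <= tau f)%E.
Proof.
apply: limf_esup_ge; near=> n; have n1 : (1 < n)%N by near: n; exact: nbhs_infty_gt.
rewrite /tau_term; case: pselect => //= fD.
rewrite lee_fin divr_ge0 ?(ltW (ln_natr_gt0 _ n1))// ln_ge0//.
by rewrite ler1n; apply: card_Delta'n_gt0; first exact: ltnW.
Unshelve. all: by end_near. Qed.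

Lemma tau_le_omega (R : realType) (r : nat) (pi : 'S_r.+1) (l : 'I_r.+1 -> R) :
  (forall i, 0 < l i) -> \sum_(i < r.+1) l i = 1 ->
  (tau (iet pi l) <= r%:R%:E * omega (iet pi l))%E.
Proof.
move=> l_pos l_sum; set T := iet pi l.
have wfin : omega T \is a fin_num.
  by rewrite fin_numElt (lt_le_trans _ (omega_ge0 T)) ?(le_lt_trans (omega_le1 T)) ?ltry.
have := omega_ge0 T; rewrite -(fineK wfin) lee_fin; set w := fine _ => w0.
apply/lee_addgt0Pr => e e0.
(* Chosen so that [r * (2 * e') <= e]; using [r.+1] avoids a division by zero when [r = 0]. *)
pose e' := e / (2 * r.+1%:R).
have r0 : 0 < r.+1%:R :> R by rewrite ltr0n.
have e'0 : 0 < e' by rewrite divr_gt0// mulr_gt0.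
have we'0 : 0 <= w + e' by rewrite addr_ge0// ltW.
have e'e : r%:R * (w + 2 * e') <= r%:R * w + e.
  have : e' * r.+1%:R = e / 2 by rewrite /e' invfM mulrA divfK// gt_eqF.
  by rewrite -natr1; nra.
apply: (@le_trans _ _ (r%:R * (w + 2 * e'))%:E); last by rewrite -EFinM -EFinD lee_fin.
have [N _ Nw] : \forall n \near \oo%classic,
    ((ln (n%:R * discrepancy T n) / ln n%:R)%:E < (w + e')%:E :> \bar R)%E.
  apply: limf_esup_lt.
  by rewrite -[X in (X < _)%E]/(omega T) -(fineK wfin) lte_fin ltrDl.
(* The upper limit controls [k * D_k] only from [N] on. For smaller [k] the trivial bound
   [k * D_k <= k] is used, and the sum of the two bounds serves all [k <= n]. *)
pose B (n : nat) : R := N.+2%:R + expR ((w + e') * ln n%:R).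
have BP (n k : nat) : (1 <= k <= n)%N -> k%:R * discrepancy T k <= B n.
  move=> /andP[k1 kn]; have [kN|Nk] := ltnP k N.+2.
    apply: (@le_trans _ _ k%:R); first by rewrite ler_piMr// discrepancy_le1.
    by rewrite (@le_trans _ _ N.+2%:R)// ?ler_nat ?(ltnW kN)// lerDl expR_ge0.
  have k1' : (1 < k)%N by exact: leq_trans Nk.
  have := Nw k (ltnW (ltnW Nk)); rewrite lte_fin ltr_pdivrMr ?ln_natr_gt0// => h.
  apply: (@le_trans _ _ (expR ((w + e') * ln k%:R))).
    rewrite -[leLHS]lnK ?ler_expR ?(ltW h)// posrE.
    exact: lt_le_trans (mul_discrepancy_ge1 T k1).
  rewrite -[leLHS]add0r lerD// ler_expR ler_wpM2l//.
  by rewrite ler_ln ?posrE ?ltr0n ?ler_nat//; exact: leq_trans kn.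
(* With [E = n^(w + e') >= 1], the base satisfies [X <= 4 * B n + 1 = 4 * N.+2 + 4 * E + 1 <= c *
   E]. *)
pose c : R := 4 * N.+2%:R + 5.
have c0 : 0 < c by rewrite ltr_wpDl// mulr_ge0.
apply: limf_esup_le; near=> n.
have n1 : (1 < n)%N by near: n; exact: nbhs_infty_gt.
have lnn := ln_natr_gt0 R n1.
(* For large [n] the constant [c] is at most [n^e']; this is the second [e'] in the final
   exponent. *)
have cn : ln c <= e' * ln n%:R.
  rewrite -ler_pdivrMl// -ler_expR lnK ?posrE ?ltr0n ?(ltnW n1)//.
  by near: n; exact: nbhs_infty_ger.
have B0 : 0 <= B n by rewrite addr_ge0// expR_ge0.
have [fD cD] := card_Delta'n_iet l_pos l_sum B0 (BP n).
rewrite /tau_term; case: pselect => // fD'; rewrite lee_fin ler_pdivrMr//.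
set X := (2 * Num.truncn (2 * B n)).+1 in cD.
have X0 : 0 < X%:R :> R by rewrite ltr0n.
have XB : X%:R <= c * expR ((w + e') * ln n%:R).
  have /andP[h _] : (Num.truncn (2 * B n))%:R <= 2 * B n < (Num.truncn (2 * B n)).+1%:R.
    by apply: truncn_itv; rewrite mulr_ge0.
  have E1 : 1 <= expR ((w + e') * ln n%:R).
    by rewrite -[leLHS]expR0 ler_expR mulr_ge0// ltW.
  have N0 : 0 <= N.+2%:R :> R by [].
  move: h; rewrite /X /c /B -[(2 * _)%N.+1%:R]natr1 natrM.
  move: (Num.truncn _)%:R E1; move: (N.+2%:R) N0 (expR _) => m m0 E t E1 h.
  by have := ler_peMr m0 E1; lra.
apply: (@le_trans _ _ (ln (X%:R ^+ r))).
  rewrite ler_ln ?posrE ?exprn_gt0 ?ltr0n ?card_Delta'n_gt0 ?(ltnW n1)//.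
  by rewrite -natrX ler_nat.
rewrite lnXn// -[leLHS]mulr_natl -mulrA ler_wpM2l//.
apply: (@le_trans _ _ (ln (c * expR ((w + e') * ln n%:R)))).
  by rewrite ler_ln ?posrE ?mulr_gt0 ?expR_gt0.
rewrite lnM ?posrE ?expR_gt0// expRK; move: cn; move: (ln c) (ln _) => u v; lra.
Unshelve. all: by end_near. Qed.

(** * Area of strips around lines of slope one *)

Local Notation mu2 R := (@product_measure1 _ _ _ _ R (@lebesgue_measure R) (@lebesgue_measure R)).

Section strips.
Context (R : realType).
Local Notation RR := (measurableTypeR R * measurableTypeR R)%type.

(** Confining the first coordinate makes the area finite: each vertical section is empty or an
    interval of length [2 * e]. *)
Definition strip (c e : R) : set RR := [set z | 0 <= z.1 < 1 /\ c - e < z.1 - z.2 < c + e].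

Lemma measurable_strip (c e : R) : measurable (strip c e).
Proof.
have -> : strip c e = ((fst : RR -> R) @^-1` `[0, 1[ `&`
    ((fst : RR -> R) \- (snd : RR -> R)) @^-1` `]c - e, c + e[)%classic.
  by apply/seteqP; split => z /=; rewrite !in_itv/=.
apply: measurableI; rewrite -[X in measurable X]setTI.
  exact: measurable_fst.
by apply: measurable_realfun.measurable_funB.
Qed.

Lemma measure_strip_le (c e : R) : 0 <= e -> (mu2 R (strip c e) <= (2 * e)%:E)%E.
Proof.
move=> e0; have mS := measurable_strip c e.
have I01 : measurable (`[0, 1[%classic : set (measurableTypeR R)) by exact: measurable_itv.
rewrite /product_measure1.
have -> : (\int[lebesgue_measure]_x (lebesgue_measure \o xsection (strip c e)) x =
    \int[lebesgue_measure]_(x in `[0%R, 1%R[) (lebesgue_measure \o xsection (strip c e)) x)%E.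
  rewrite [RHS]integral_mkcond; apply: eq_integral => x _; rewrite patchE; case: ifPn => //.
  rewrite notin_setE/= in_itv/= => x01.
  rewrite (_ : xsection _ _ = set0) ?measure0//.
  by apply/seteqP; split => // y /xsectionP[/=].
apply: (@le_trans _ _ (\int[lebesgue_measure]_(x in `[0%R, 1%R[) (cst (2 * e)%:E) x)%E).
  apply: ge0_le_integral => //=.
  - by apply: (@measurable_funS _ _ _ _ setT) => //; exact: measurable_fun_xsection.
  - move=> x _.
    apply: (@le_trans _ _ (lebesgue_measure (`]x - (c + e), x - (c - e)[%classic : set R))).
      apply: le_measure; rewrite ?inE; [exact: measurable_xsection|exact: measurable_itv|].
      by move=> y /xsectionP[/= _ /andP[h1 h2]]; rewrite /= in_itv/=; apply/andP; split; lra.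
    rewrite lebesgue_measure_itv/= lte_fin; case: ifP => _; last by rewrite lee_fin mulr_ge0.
    by rewrite -EFinD lee_fin; lra.
by rewrite integral_cst//= lebesgue_measure_itv/= lte_fin ltr01 -EFinD subr0 mule1.
Qed.

Lemma measure_bigsetU_le (I : Type) (s : seq I) (F : I -> set RR) (b : R) :
  0 <= b -> (forall i, measurable (F i)) -> (forall i, mu2 R (F i) <= b%:E)%E ->
  measurable (\big[setU/set0]_(i <- s) F i) /\
  (mu2 R (\big[setU/set0]_(i <- s) F i) <= ((size s)%:R * b)%:E)%E.
Proof.
move=> b0 mF Fb; elim: s => [|i s [mIH IH]].
  by rewrite big_nil measure0 mul0r; split; [exact: measurable0|exact: lexx].
rewrite big_cons; split; first exact: measurableU.
apply: (le_trans (measureU2 (mu2 R) (mF i) mIH)).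
by rewrite /= -natr1 mulrDl mul1r addrC EFinD; exact: leeD.
Qed.

End strips.

(** * Borel-Cantelli and the first inequality *)

Lemma distZ_lt (R : realType) (t e : R) : distZ t < e -> exists m : int, `|t - m%:~R| < e.
Proof.
rewrite /distZ; have /andP[f0 f1] := frac_itv t.
have [_ fe|_ fe] := leP (frac t) (1 - frac t).
  by exists (Num.floor t); rewrite -/(frac t) ger0_norm.
exists (Num.floor t + 1); rewrite intrD1.
have -> : t - ((Num.floor t)%:~R + 1) = - (1 - frac t) by rewrite /Defs.frac; ring.
by rewrite normrN ger0_norm// subr_ge0 ltW.
Qed.

Lemma distZ_ge0 (R : realType) (t : R) : 0 <= distZ t.
Proof.
by rewrite /distZ le_min; have /andP[-> /ltW] := frac_itv t; rewrite subr_ge0.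
Qed.

(* For each [d] only four integers can be within distance [1] of [x - y + d]. *)
Lemma near_strip (R : realType) (x y d t e : R) (q : int) :
  0 <= x < 1 -> 0 <= y < 1 -> 0 <= d < 1 -> e <= 1 ->
  t = x - y + d + q%:~R -> distZ t < e ->
  exists i : 'I_4, strip (i%:R - 1 - d) e (x, y).
Proof.
move=> x01 y01 /andP[d0 d1] e1 -> /distZ_lt[m].
have -> : x - y + d + q%:~R - m%:~R = x - y + d - (m - q)%:~R by rewrite intrB; ring.
move: (m - q) => {}m; rewrite ltr_norml => /andP[h1 h2].
have /andP[x0 x1] := x01; have /andP[y0 y1] := y01.
(* As [x - y + d] lies in [(-1, 2)] and [e <= 1], [m] is one of [-1, 0, 1, 2], written below as
   [k - 1]. *)
have m1 : (-2 < m)%R by rewrite -(ltr_int R); lra.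
have m2 : (m < 3)%R by rewrite -(ltr_int R); lra.
have [k km] : exists k : nat, m = k%:Z - 1 by exists `|(m + 1)%R|%N; lia.
have k4 : (k < 4)%N by lia.
exists (Ordinal k4); split => //=.
by move: h1 h2; rewrite km intrB => *; apply/andP; split; lra.
Qed.

Lemma natX_powR (R : realType) (p m : nat) (x : R) :
  (p ^ m)%:R `^ x = (p%:R `^ x) ^+ m.
Proof. by rewrite natrX -(powR_mulrn m (ler0n R p)) -powRrM mulrC powRrM powR_mulrn ?powR_ge0. Qed.

Lemma limn_einf_eq0_lt1 (R : realType) (u : nat -> R) (K : nat) :
  limn_einf (fun n => (u n)%:E) = 0%E -> exists2 n, (K <= n)%N & u n < 1.
Proof.
move=> u0; apply: contrapT => h.
suff : (1 <= limn_einf (fun n => (u n)%:E))%E by rewrite u0 lee_fin ler10.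
rewrite /limn_einf leeNr; apply: limf_esup_le; near=> n.
rewrite lee_fin lerN2 leNgt; apply/negP => un; apply: h; exists n => //.
by near: n; exact: nbhs_infty_ge.
Unshelve. all: by end_near. Qed.

(** Borel-Cantelli: the measures sum to at most [C / (1 - a)]. *)
Lemma measure_lim_sup_geometric (R : realType) (d : measure_display) (X : measurableType d)
    (mu : {measure set X -> \bar R}) (F : (set X)^nat) (C a : R) :
  0 <= C -> 0 < a < 1 -> (forall k, measurable (F k)) ->
  (forall k, mu (F k) <= (C * a ^+ k)%:E)%E -> mu (lim_sup_set F) = 0%E.
Proof.
move=> C0 /andP[a0 a1] mF FC; apply: lim_sup_set_cvg0 => //.
apply: (@le_lt_trans _ _ (C / (1 - a))%:E); last exact: ltry.
apply: lime_le; first exact: is_cvg_nneseries.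
apply: nearW => n; apply: le_trans (lee_sum _ (fun k _ => FC k)) _.
by rewrite sumEFin lee_fin; apply: geometric_le_lim; rewrite ?ger0_norm// ltW.
Qed.

(** By contradiction: an admissible [alpha > tau f] would place almost every point of the unit
    square in a null upper limit set, although the square has area [1]. *)
Lemma Cpsi_le_tau (R : realType) (f : R -> R) : (Cpsi f <= tau f)%E.
Proof.
apply: ge_ereal_sup => _ [->|[alpha [alpha0 fa] <-]]; first exact: tau_ge0.
rewrite leNgt; apply/negP => ta.
have t0 := tau_ge0 f.
have tfin : tau f \is a fin_num by rewrite fin_numElt (lt_le_trans _ t0)// (lt_trans ta) ?ltry.
pose beta := (fine (tau f) + alpha) / 2.
move: ta t0; rewrite -(fineK tfin) lte_fin lee_fin => ta t0.
have [ab b0] : beta < alpha /\ 0 < beta by split; rewrite /beta; lra.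
have [N _ Nt] : \forall n \near \oo%classic, (tau_term f n < beta%:E)%E.
  apply: limf_esup_lt; rewrite -[X in (X < _)%E]/(tau f) -(fineK tfin) lte_fin /beta; lra.
have card_le (n : nat) : (1 < n)%N -> (N <= n)%N -> finite_set (Delta'n f n) /\
    (#|` fset_set (Delta'n f n)|)%:R <= n%:R `^ beta.
  (* An infinite [Delta'n f n] would give [tau_term] the value [+oo], so the strict bound also
     yields finiteness. *)
  move=> n1 /Nt; rewrite /tau_term /=; case: pselect => //= fD; rewrite lte_fin => h.
  split=> //; rewrite -ler_ln ?posrE ?powR_gt0 ?ltr0n ?card_Delta'n_gt0 ?(ltnW n1)//.
  by rewrite ln_powR ltW// -ltr_pdivrMr// ln_natr_gt0.
(* Block [k] consists of the times [n] with [2^(k+N) <= n < 2^(k+N+1)]. Its lower end gives the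
   largest width [n^(- alpha)], its upper end a set of differences valid for all its times. The
   offset [N] puts every block in the range of [card_le]. *)
pose eps k : R := (2 ^ (k + N))%:R `^ (- alpha).
pose D k := fset_set (Delta'n f (2 ^ (k + N).+1)).
pose centers k := [seq (i : 'I_4)%:R - 1 - d | d <- D k, i <- enum 'I_4].
pose F k := \big[setU/set0]_(c <- centers k) strip c (eps k).
have D_le k : finite_set (Delta'n f (2 ^ (k + N).+1)) /\
    (#|` D k|)%:R <= (2 ^ (k + N).+1)%:R `^ beta.
  apply: card_le; first by apply: leq_ltn_trans (ltn_expl _ _).
  by apply: ltnW; apply: leq_ltn_trans (ltn_expl _ _); lia.
pose a : R := 2 `^ (beta - alpha).
have a1 : a < 1.
  by rewrite /a /powR gt_eqF// -[ltRHS]expR0 ltr_expR pmulr_llt0 ?ln_gt0 ?ltr1n ?subr_lt0.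
have FE k : measurable (F k) /\
    (mu2 R (F k) <= ((size (centers k))%:R * (2 * eps k))%:E)%E.
  apply: measure_bigsetU_le; first by rewrite mulr_ge0// powR_ge0.
    by move=> c; exact: measurable_strip.
  by move=> c; apply: measure_strip_le; exact: powR_ge0.
have F0 : mu2 R (lim_sup_set F) = 0%E.
  (* Four strips for each difference, each of area at most [2 * eps k], account for the [8]; the
     factor [2^beta] comes from the upper end of the block. *)
  apply: (@measure_lim_sup_geometric _ _ _ _ _ (8 * 2 `^ beta * a ^+ N) a).
  - by rewrite !mulr_ge0// ?exprn_ge0// powR_ge0.
  - by rewrite a1 powR_gt0.
  - by move=> k; have [] := FE k.
  - move=> k; have [_ /le_trans] := FE k; apply; rewrite lee_fin.
    rewrite size_allpairs size_enum_ord natrM.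
    have -> : 8 * 2 `^ beta * a ^+ N * a ^+ k =
        (2 ^ (k + N).+1)%:R `^ beta * 4 * (2 * eps k).
      rewrite /eps !natX_powR exprS /a powRD ?pnatr_eq0 ?implybT// !exprMn !exprD; ring.
    by rewrite !ler_wpM2r ?mulr_ge0 ?powR_ge0//; have [] := D_le k.
have I01 : measurable (`[0, 1[%classic : set (measurableTypeR R)) by exact: measurable_itv.
have mlimF : measurable (lim_sup_set F).
  by apply: bigcap_measurable => // n _; apply: bigcup_measurable => k _; have [] := FE k.
pose Q := (`[0, 1[ `*` `[0, 1[)%classic : set (measurableTypeR R * measurableTypeR R).
have : mu2 R Q = 0%E.
  apply: measure_negligible; first exact: measurableX.
  have limF : (mu2 R).-negligible (lim_sup_set F) by exists (lim_sup_set F); split.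
  apply: negligibleS (negligibleU fa limF) => -[x y] [/= x01 y01].
  (* A point of the square either has lower limit [0], and then it lies in infinitely many [F k], or
     belongs to the exceptional null set of [fa]. *)
  have [h|] := pselect (limn_einf (fun n =>
      (n%:R `^ alpha * distZ (iter n f x - iter n f y))%:E) = 0%E).
    right => K _.
    have [n Kn un] := limn_einf_eq0_lt1 (2 ^ (K + N)) h.
    have n0 : (0 < n)%N by apply: leq_trans Kn; rewrite expn_gt0.
    (* [L] locates the dyadic block of [n]: its index is [L - N], which is at least [K] because
       [n >= 2^(K + N)]. *)
    have /andP[l1 l2] := trunc_log_bounds (isT : (1 < 2)%N) n0.
    have Kl : (K + N <= trunc_log 2 n)%N by exact: trunc_log_max.
    move: (trunc_log 2 n) l1 l2 Kl => L l1 l2 Kl.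
    have LN : (L - N + N)%N = L by apply: subnK; exact: leq_trans (leq_addl K N) Kl.
    exists (L - N)%N; first by rewrite /= -(leq_add2r N) LN.
    pose u := (iter n f x - x) - (iter n f y - y).
    have uD : frac u \in D (L - N)%N.
      have [fD _] := D_le (L - N)%N; rewrite /D in_fset_set// inE.
      exists n; first by rewrite /= n0 LN ltnW.
      exists (ominus1 (iter n f x) x, ominus1 (iter n f y) y); last exact: ominus1_ominus1.
      by split; [exists x | exists y].
    rewrite in_itv/= in x01; rewrite in_itv/= in y01.
    have p0 : 0 < (2 ^ L)%:R :> R by rewrite ltr0n expn_gt0.
    have eps1 : eps (L - N)%N <= 1.
      by rewrite /eps LN -[leRHS](powRr0 (2 ^ L)%:R) ler_powR ?ler1n ?expn_gt0// oppr_le0 ltW.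
    have fn : distZ (iter n f x - iter n f y) < eps (L - N)%N.
      rewrite /eps LN powRN -[ltRHS]mulr1 ltr_pdivlMl ?powR_gt0//; apply: le_lt_trans un.
      rewrite ler_wpM2r ?distZ_ge0// ge0_ler_powR ?nnegrE ?ler0n ?ler_nat//; exact: ltW.
    have uE : iter n f x - iter n f y = x - y + frac u + (Num.floor u)%:~R.
      by rewrite /Defs.frac /u; ring.
    have [i zi] := near_strip x01 y01 (frac_itv u) eps1 uE fn.
    rewrite /F -bigcup_seq; exists (i%:R - 1 - frac u) => //=.
    by apply/allpairsP; exists (frac u, i); split=> //; rewrite mem_enum.
  by move=> h; left => /= /(_ x01 y01).
rewrite product_measure1E//= lebesgue_measure_itv/= lte_fin ltr01 -EFinD subr0 mule1.
by move=> /eqP; rewrite eqe oner_eq0.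
Qed.

Theorem theorem11p7 (R : realType) (r : nat) (pi : 'S_r) (l : 'I_r -> R)
  (l_pos : forall i, 0 < l i) (l_sum : \sum_(i < r) l i = 1) :
  let T := iet pi l in
  ((Cpsi T <= tau T)%E /\ (tau T <= (r.-1)%:R%:E * omega T)%E) /\
  (omega T = 0%E -> tau T = 0%E /\ Cpsi T = 0%E).
Proof.
case: r pi l l_pos l_sum => [|r] pi l l_pos l_sum.
  by move: l_sum; rewrite big_ord0 => /eqP; rewrite eq_sym oner_eq0.
move=> T; have Ct := Cpsi_le_tau T.
have tw : (tau T <= r%:R%:E * omega T)%E by exact: tau_le_omega.
split=> // w0; have t0 : tau T = 0%E.
  by apply/eqP; rewrite eq_le tau_ge0 andbT; move: tw; rewrite w0 mule0.
(* [Cpsi T] is nonnegative because [0] is adjoined to the set of exponents. *)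
split=> //; apply/eqP; rewrite eq_le -{1}t0 Ct; apply: ereal_sup_ubound.
by left.
Qed.
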